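(* As formal power series in $q$, $$\gamma^6 = 59049 \xi^{10} - 262440 \xi^{11} + 466560 \xi^{12} - 414720 \xi^{13} + 184320 \xi^{14} - 32768 \xi^{15}.$$
   Context: Let $E(q)=\prod_{m\ge1}(1-q^m)$. Define $$\gamma=\gamma(q)=\frac{E(q)^5E(q^2)^5E(q^6)^5}{E(q^3)^{15}},\qquad \xi=\xi(q)=\frac{E(q^2)^5E(q^6)}{E(q)E(q^3)^5}.$$ *)

(* Defs.v *)
From mathcomp Require Import all_boot all_order all_algebra.
Set Implicit Arguments. Unset Strict Implicit. Unset Printing Implicit Defensive.
Import Order.TTheory GRing.Theory Num.Theory.
Local Open Scope ring_scope.

Definition fps := nat -> rat.

Definition fone : fps := fun n => (n == 0)%:R.

Definition fmul (f g : fps) : fps := fun n => \sum_(i < n.+1) f i * g (n - i)%N.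

Fixpoint fpow (f : fps) (k : nat) : fps :=
  match k with 0 => fone | k'.+1 => fmul f (fpow f k') end.

(* Multiplicative inverse of a power series with nonzero constant term:
   g_0 = 1/f_0, g_n = -(1/f_0) * sum_{i=1}^n f_i g_{n-i}.
   inv_seq f n = [:: g_0; ...; g_n]. *)
Fixpoint inv_seq (f : fps) (n : nat) : seq rat :=
  match n with
  | 0 => [:: (f 0%N)^-1]
  | n'.+1 => let s := inv_seq f n' in
      rcons s (- (f 0%N)^-1 *
               \sum_(1 <= i < n'.+2) f i * nth 0 s (n'.+1 - i)%N)
  end.

Definition finv (f : fps) : fps := fun n => nth 0 (inv_seq f n) n.

(* E(q^k) = prod_{m>=1} (1 - q^{k m}) as a formal power series: for k >= 1
   the coefficient of q^n only depends on the factors with m <= n. *)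
Definition Eq (k : nat) : fps :=
  fun n => (\prod_(1 <= m < n.+1) (1 - 'X^(k * m)) : {poly rat})`_n.

Definition gamma : fps :=
  fmul (fpow (Eq 1) 5) (fmul (fpow (Eq 2) 5)
    (fmul (fpow (Eq 6) 5) (finv (fpow (Eq 3) 15)))).

Definition xi : fps :=
  fmul (fmul (fpow (Eq 2) 5) (Eq 6))
       (finv (fmul (Eq 1) (fpow (Eq 3) 5))).

(* Main.v *)
Require Import Defs.
From mathcomp Require Import all_boot all_order all_algebra all_field.
From mathcomp Require Import ring zify.
From Stdlib Require Import Setoid Morphisms.
Set Implicit Arguments. Unset Strict Implicit. Unset Printing Implicit Defensive.
Import GRing.Theory.
Local Open Scope ring_scope.

(** The right-hand side is xi^10 (9 - 8 xi)^5, so it suffices to show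
    9 - 8 xi = E1^8 E6^4 / (E2^4 E3^8), that is
    9 E1 E2^4 E3^8 = 8 E2^9 E3^3 E6 + E1^9 E6^4, where Ek = E(q^k).

    Let phi = sum (-1)^n q^(n^2), psi = sum q^(2n^2+n), A = sum q^(n(3n+1)/2),
    Omega = sum (-1)^n q^(3n^2+2n), over all integers n. Jacobi's triple product
    turns them into quotients of the Ek. Splitting the series modulo 3 gives
    phi(q) = phi(q^9) - 2 q Omega(q^3) and psi(q) = A(q^3) + q psi(q^9).
    Taking the product over q, wq, w^2 q with w a primitive cube root of unity,
    the Ek transform by E(q) E(wq) E(w^2 q) = E(q^3)^4 / E(q^9), hence
    phi(q^3)^3 - 8 q Omega^3 = E1^8 E6 / (E2^4 E3^2) and
    A^3 + q psi(q^3)^3 = E2^8 E3 / (E1^4 E6^2).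
    Eliminating phi(q^3), psi(q^3), A, Omega and q yields the claim.

    All this takes place between polynomials modulo X^N, with N arbitrary. *)

(* A [Variant], because ssreflect's [rewrite] would unfold an alias of the boolean
   divisibility and not see a setoid relation. *)
Variant eqmodX {F : fieldType} (N : nat) (p q : {poly F}) : Prop :=
  EqmodX of 'X^N %| p - q.

Lemma eqmodXP {F : fieldType} {N : nat} {p q : {poly F}} :
  reflect (eqmodX N p q) ('X^N %| p - q).
Proof. by apply: (iffP idP) => [h|[]]. Qed.

(** * Congruence of polynomials modulo X^N *)

Section Congruence.
Variables (F : fieldType) (N : nat).
Implicit Types p q r : {poly F}.
Local Notation "p === q" := (eqmodX N p q) (at level 70).

Lemma eqmodX_coef p q : p === q <-> forall i, (i < N)%N -> p`_i = q`_i.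
Proof.
split.
  case; rewrite /dvdp -Pdiv.IdomainMonic.take_poly_modp => /eqP h i iN.
  apply/eqP; rewrite -subr_eq0 -coefB.
  by have := congr1 (fun s : {poly F} => s`_i) h; rewrite coef_take_poly iN coef0 => ->.
move=> h; apply/eqmodXP; rewrite /dvdp -Pdiv.IdomainMonic.take_poly_modp.
apply/eqP/polyP => i; rewrite coef_take_poly coef0.
by case: ifP => // iN; rewrite coefB h // subrr.
Qed.

#[local] Instance eqmodX_equiv : Equivalence (@eqmodX F N).
Proof.
split=> [p|p q [h]|p q r [h1] [h2]]; apply/eqmodXP.
- by rewrite subrr dvdp0.
- by rewrite -opprB dvdpNr.
- by rewrite -(subrKA q) dvdp_add.
Qed.

#[local] Instance eqmodX_mul : Proper (@eqmodX F N ==> @eqmodX F N ==> @eqmodX F N) *%R.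
Proof.
move=> p p' [hp] q q' [hq]; apply/eqmodXP.
have -> : p * q - p' * q' = (p - p') * q + p' * (q - q') by ring.
by apply: dvdp_add; [apply: dvdp_mulr | apply: dvdp_mull].
Qed.

#[local] Instance eqmodX_add : Proper (@eqmodX F N ==> @eqmodX F N ==> @eqmodX F N) +%R.
Proof.
move=> p p' [hp] q q' [hq]; apply/eqmodXP.
have -> : p + q - (p' + q') = (p - p') + (q - q') by ring.
by rewrite dvdp_add.
Qed.

#[local] Instance eqmodX_opp : Proper (@eqmodX F N ==> @eqmodX F N) -%R.
Proof. by move=> p p' [hp]; apply/eqmodXP; rewrite -opprD dvdpNr. Qed.

#[local] Instance eqmodX_exp : Proper (@eqmodX F N ==> eq ==> @eqmodX F N) (@GRing.exp _).
Proof.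
move=> p p' hp k _ <-; elim: k => [|k IH]; first by rewrite !expr0; reflexivity.
by rewrite !exprS; exact: (eqmodX_mul hp IH).
Qed.

Lemma eq_eqmodX p q : p = q -> p === q.
Proof. by move=> ->; reflexivity. Qed.

(** A nonzero constant term makes [u] coprime to X, hence to X^N. Denominators are cleared this
    way. *)
Lemma eqmodX_cancel (u p q : {poly F}) : u`_0 != 0 -> u * p === u * q -> p === q.
Proof.
move=> u0 [h]; apply/eqmodXP; move: h; rewrite -mulrBr Gauss_dvdpr //.
rewrite coprimep_expl // coprimep_sym -['X]subr0 -polyC0.
by rewrite coprimep_XsubC /root horner_coef0.
Qed.

End Congruence.

Lemma eqmodX_scale (F : fieldType) N (c : F) (p q : {poly F}) :
  eqmodX N p q -> eqmodX N (p \Po (c *: 'X)) (q \Po (c *: 'X)).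
Proof.
move=> [h]; apply/eqmodXP; rewrite -comp_polyB.
apply: dvdp_trans (dvdp_comp_poly _ h); rewrite comp_Xn_poly exprZn.
by rewrite -mul_polyC dvdp_mull.
Qed.

(** Descends from q^d to q: coefficient i of [p] becomes coefficient d i, whence the precision d
    N. *)
Lemma eqmodX_expand (F : fieldType) N d (p q : {poly F}) : (0 < d)%N ->
  eqmodX (d * N) (p \Po 'X^d) (q \Po 'X^d) -> eqmodX N p q.
Proof.
move=> d0 /eqmodX_coef h; apply/eqmodX_coef => i iN.
have := h (d * i)%N; rewrite !coef_comp_poly_Xn // dvdn_mulr // mulKn //.
by apply; rewrite ltn_pmul2l.
Qed.

#[local] Existing Instances eqmodX_equiv eqmodX_mul eqmodX_add eqmodX_opp eqmodX_exp.

Lemma eqmodX_map (F K : fieldType) (f : {rmorphism F -> K}) N (p q : {poly F}) :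
  eqmodX N (map_poly f p) (map_poly f q) <-> eqmodX N p q.
Proof.
by split=> -[h]; apply/eqmodXP; move: h; rewrite -rmorphB /= -(map_polyXn f) dvdp_map.
Qed.

(** * Truncation of formal power series *)

Definition trunc (N : nat) (f : fps) : {poly rat} := \poly_(i < N) f i.

Lemma truncM N f g : eqmodX N (trunc N (fmul f g)) (trunc N f * trunc N g).
Proof.
apply/eqmodX_coef => n nN; rewrite coef_poly nN coefM; apply: eq_bigr => i _.
by rewrite !coef_poly ifT ?ifT //; move: (ltn_ord i); lia.
Qed.

Lemma trunc1 N : eqmodX N (trunc N fone) 1.
Proof. by apply/eqmodX_coef => n nN; rewrite coef_poly nN coef1. Qed.

Lemma truncX N f k : eqmodX N (trunc N (fpow f k)) (trunc N f ^+ k).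
Proof.
elim: k => [|k IH] /=; first by rewrite expr0; apply: trunc1.
by rewrite exprS truncM IH; reflexivity.
Qed.

Lemma size_inv_seq f n : size (inv_seq f n) = n.+1.
Proof. by elim: n => //= n IH; rewrite size_rcons IH. Qed.

(* [Defs.] is needed because fingraph also defines [finv]. *)
Lemma nth_inv_seq f n i : (i <= n)%N -> nth 0 (inv_seq f n) i = Defs.finv f i.
Proof.
elim: n => [|n IH]; first by case: i.
rewrite leq_eqVlt => /orP[/eqP -> //|iN] /=.
by rewrite nth_rcons size_inv_seq iN IH.
Qed.

Lemma fmulV f n : f 0%N != 0 -> fmul f (Defs.finv f) n = fone n.
Proof.
move=> f0; rewrite /fmul; case: n => [|n].
  by rewrite big_ord_recl big_ord0 addr0 /Defs.finv /= mulfV.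
rewrite big_ord_recl /= {1}/Defs.finv /= nth_rcons size_inv_seq ltnn eqxx.
rewrite mulrA mulrN divff // mulN1r big_add1 big_mkord /=; apply/eqP.
rewrite addrC subr_eq0; apply/eqP/eq_bigr => i _.
by rewrite nth_inv_seq // /bump; lia.
Qed.

Lemma truncV N f : f 0%N != 0 -> eqmodX N (trunc N f * trunc N (Defs.finv f)) 1.
Proof.
move=> f0; rewrite -truncM; apply/eqmodX_coef => n nN.
by rewrite coef_poly nN fmulV // coef1.
Qed.

(** * Gaussian binomials and the q-binomial theorem *)

Section QBinomial.
Variables (R : comNzRingType) (Q : R).

(** Gaussian binomials by the q-Pascal rule, which avoids division in [R]. *)
Fixpoint qbin (n k : nat) : R :=
  match n, k with
  | _, 0 => 1
  | 0, _.+1 => 0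
  | n'.+1, k'.+1 => qbin n' k' + Q ^+ k'.+1 * qbin n' k'.+1
  end.

Definition qpoch (n : nat) : R := \prod_(j < n) (1 - Q ^+ j.+1).

Lemma qbinS n k : qbin n.+1 k.+1 = qbin n k + Q ^+ k.+1 * qbin n k.+1.
Proof. by []. Qed.

Lemma qbin0 n : qbin n 0 = 1.
Proof. by case: n. Qed.

Lemma qbin_small n k : (n < k)%N -> qbin n k = 0.
Proof.
elim: n k => [|n IH] [|k] //= nk.
by rewrite !IH ?mulr0 ?addr0 // ltnW.
Qed.

(** Pascal's rule reduces the induction to 1 - Q^(n+1) = (1 - Q^(k+1)) + Q^(k+1) (1 - Q^(n-k)). *)
Lemma qbin_qpoch n k : (k <= n)%N ->
  qbin n k * qpoch k * qpoch (n - k) = qpoch n.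
Proof.
have qpS m : qpoch m.+1 = qpoch m * (1 - Q ^+ m.+1) by rewrite /qpoch big_ord_recr.
have qp0 : qpoch 0 = 1 by rewrite /qpoch big_ord0.
elim: n k => [|n IH] [|k]; rewrite ?qbin0 ?qp0 ?subn0 ?mul1r //.
rewrite ltnS leq_eqVlt subSS qbinS => /orP[/eqP ->|kn].
  have := IH n (leqnn n); rewrite subnn qp0 !mulr1 => h.
  rewrite [qbin n n.+1]qbin_small // mulr0 addr0 qpS.
  by rewrite mulrA h.
have h1 := IH k (ltnW kn); have h2 := IH k.+1 kn.
have := qpS (n - k.+1)%N; rewrite subnSK // => h3.
have -> : (qbin n k + Q ^+ k.+1 * qbin n k.+1) * qpoch k.+1 * qpoch (n - k) =
  (1 - Q ^+ k.+1) * (qbin n k * qpoch k * qpoch (n - k)) +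
  Q ^+ k.+1 * (1 - Q ^+ (n - k)) * (qbin n k.+1 * qpoch k.+1 * qpoch (n - k.+1)).
  by rewrite h3 qpS; ring.
rewrite h1 h2 qpS.
have -> : Q ^+ n.+1 = Q ^+ k.+1 * Q ^+ (n - k) by rewrite -exprD addSn subnKC // ltnW.
by ring.
Qed.

(** Induction on n: the factor i = 0 is y + x, the others form the product for x Q. The two
    resulting sums merge by Pascal's rule. *)
Lemma qbinomial_theorem (x y : R) n :
  \prod_(i < n) (y + x * Q ^+ i) =
  \sum_(k < n.+1) qbin n k * Q ^+ 'C(k, 2) * x ^+ k * y ^+ (n - k).
Proof.
elim: n x => [|n IH] x.
  by rewrite big_ord0 big_ord_recl big_ord0 /= !expr0 !mulr1 addr0.
rewrite big_ord_recl expr0 mulr1.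
under eq_bigr => i _ do rewrite /= /bump add1n exprS mulrA.
rewrite IH mulrDl; set S := \sum_(k < _) _.
have -> : y * S = \sum_(k < n.+2) Q ^+ k * qbin n k * Q ^+ 'C(k, 2) * x ^+ k * y ^+ (n.+1 - k).
  have -> : \sum_(k < n.+2) Q ^+ k * qbin n k * Q ^+ 'C(k, 2) * x ^+ k * y ^+ (n.+1 - k) =
    \sum_(k < n.+1) Q ^+ k * qbin n k * Q ^+ 'C(k, 2) * x ^+ k * y ^+ (n.+1 - k).
    by rewrite big_ord_recr /= qbin_small // !(mulr0, mul0r) addr0.
  rewrite mulr_sumr; apply: eq_bigr => k _.
  rewrite (subSn (ltn_ord k : k <= n)%N) exprS exprMn.
  by move: (qbin n k) (Q ^+ 'C(k, 2)) (Q ^+ k) (x ^+ k) (y ^+ (n - k)) => *; ring.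
have -> : x * S = \sum_(k < n.+1) qbin n k * Q ^+ 'C(k.+1, 2) * x ^+ k.+1 * y ^+ (n - k).
  rewrite mulr_sumr; apply: eq_bigr => k _.
  rewrite binS bin1 exprD exprS exprMn.
  by move: (qbin n k) (Q ^+ 'C(k, 2)) (Q ^+ k) (x ^+ k) (y ^+ (n - k)) => *; ring.
rewrite big_ord_recl [RHS]big_ord_recl -addrA -big_split /= qbin0 !expr0 mul1r.
congr (_ + _); first by rewrite mulr1.
apply: eq_bigr => k _.
by rewrite /bump add1n subSS !mulrDl addrC.
Qed.

End QBinomial.

(** * Jacobi's triple product, in finite form and modulo X^N *)

Lemma eqmodX_sum (F : fieldType) N I (r : seq I) (f g : I -> {poly F}) :
  (forall i, eqmodX N (f i) (g i)) ->
  eqmodX N (\sum_(i <- r) f i) (\sum_(i <- r) g i).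
Proof.
move=> fg; elim/big_ind2: _ => [|p q p' q' -> ->|i _]; [reflexivity..|exact: fg].
Qed.

Lemma eqmodX_Xn (F : fieldType) N n : (N <= n)%N -> eqmodX N ('X^n : {poly F}) 0.
Proof. by move=> h; apply/eqmodXP; rewrite subr0 dvdp_exp2l. Qed.

Lemma binD2 m n : 'C(m + n, 2) = ('C(m, 2) + 'C(n, 2) + m * n)%N.
Proof.
elim: n => [|n IH]; first by rewrite addn0 muln0 !addn0.
by rewrite addnS !binS IH !bin1; lia.
Qed.

Lemma sqrn_bin2 n : (n * n = 2 * 'C(n, 2) + n)%N.
Proof. by elim: n => // n IH; rewrite binS bin1; lia. Qed.

Section JacobiTriple.
Variable F : fieldType.

(* [eulerp k L] truncates E(q^k) *)
Definition eulerp (k L : nat) : {poly F} := \prod_(j < L) (1 - 'X^(k * j.+1)).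

(* Partial sums of sum_{n in Z} e^n q^{(s + t) n (n - 1) / 2 + s n}, the second
   sum collecting the indices -n-1; this is Ramanujan's f(e q^s, e q^t). *)
Definition theta (e : {poly F}) (s t M : nat) : {poly F} :=
  \sum_(n < M) e ^+ n * 'X^((s + t) * 'C(n, 2) + s * n)
  + \sum_(n < M) e ^+ n.+1 * 'X^((s + t) * 'C(n.+1, 2) + t * n.+1).

Lemma qpoch_eulerp k L : qpoch ('X^k : {poly F}) L = eulerp k L.
Proof. by apply: eq_bigr => j _; rewrite exprM. Qed.

Lemma finite_jacobi_triple (e : {poly F}) s t M : e * e = 1 ->
  \prod_(j < M) ((1 + e * 'X^(s + (s + t) * j)) * (1 + e * 'X^(t + (s + t) * j))) =
  \sum_(n < M.+1) qbin 'X^(s + t) (M + M) (M + n)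
     * (e ^+ n * 'X^((s + t) * 'C(n, 2) + s * n))
  + \sum_(n < M) qbin 'X^(s + t) (M + M) (M - n.+1)
     * (e ^+ n.+1 * 'X^((s + t) * 'C(n.+1, 2) + t * n.+1)).
Proof.
(* Rothe's q-binomial theorem with Q = q^a, x = e q^s, y = q^(a M) and 2M factors:
   y makes all exponents nonnegative, at the cost of the common factor c. *)
move=> ee; pose a := (s + t)%N.
pose c : {poly F} := e ^+ M * 'X^(a * M * M + s * M + a * 'C(M, 2)).
have e0 : e != 0 by apply: contra_eq_neq ee => ->; rewrite mul0r eq_sym oner_neq0.
have c0 : c != 0 by rewrite mulf_neq0 ?expf_neq0 ?polyX_eq0.
apply: (mulfI c0).
have := qbinomial_theorem 'X^a (e * 'X^s) 'X^(a * M) (M + M).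
(* Factor M + j is q^(a M) (1 + e q^(s + a j)). Since e e = 1, factor M - j - 1 is e q^(s + a (M - j
   - 1)) (1 + e q^(t + a j)). The monomials in front multiply to [c]. *)
have -> : \prod_(i < M + M) ('X^(a * M) + e * 'X^s * 'X^a ^+ i) =
    c * \prod_(j < M) ((1 + e * 'X^(s + a * j)) * (1 + e * 'X^(t + a * j))).
  rewrite big_split_ord /= [X in X * _](reindex_inj rev_ord_inj) /= -big_split /=.
  have -> : c = \prod_(j < M) (e * 'X^(s + a * (M - j.+1)) * 'X^(a * M)).
    have <- : \prod_(j < M) (e * 'X^(s + a * j) * 'X^(a * M)) =
        \prod_(j < M) (e * 'X^(s + a * (M - j.+1)) * 'X^(a * M)).
      by rewrite (reindex_inj rev_ord_inj).
    rewrite /c {c c0}; move: (a * M)%N => u; elim: M => [|m IH].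
      by rewrite big_ord0 !muln0 expr0 mul1r.
    rewrite big_ord_recr /= -IH binS bin1 exprS.
    have -> : (u * m.+1 + s * m.+1 + a * ('C(m, 2) + m) =
      (u * m + s * m + a * 'C(m, 2)) + ((s + a * m) + u))%N by lia.
    rewrite !(exprD _ (_ + _ + _)%N) !(exprD _ _ u).
    by move: (e ^+ m) ('X^_) ('X^_) ('X^_) => *; ring.
  rewrite -big_split /=; apply: eq_bigr => j _.
  have jM := ltn_ord j.
  have h1 : (a * M = s + a * (M - j.+1) + (t + a * j))%N.
    by rewrite {2}(_ : a = s + t)%N // /a; nia.
  rewrite -!exprM -!mulrA -!exprD mulnDr !exprD.
  have -> : 'X^(a * M) = 'X^s * 'X^(a * (M - j.+1)) * ('X^t * 'X^(a * j)) :> {poly F}.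
    by rewrite -!exprD -h1.
  have key (x1 x2 x3 x4 : {poly F}) :
      (x1 * x3 * (x2 * x4) + e * (x1 * x3)) *
      (x1 * x3 * (x2 * x4) + e * (x1 * (x1 * x3 * (x2 * x4) * x4))) =
      e * (x1 * x3 * (x1 * x3 * (x2 * x4) *
        ((1 + e * (x1 * x4)) * (1 + e * (x2 * x4))))).
    have -> : x1 * x3 * (x2 * x4) + e * (x1 * x3) = e * (x1 * x3) * (1 + e * (x2 * x4)).
      by rewrite mulrDr mulr1 addrC; congr (_ + _); rewrite -[LHS]mul1r -ee; ring.
    by ring.
  exact: key.
(* Reduces the comparison of a q-binomial term with a theta term to the exponents of e and q. *)
have monomial m p q u v : e ^+ m = e ^+ M * e ^+ p ->
    (u + s * m + v = a * M * M + s * M + a * 'C(M, 2) + q)%N ->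
    forall b : {poly F}, b * 'X^u * (e * 'X^s) ^+ m * 'X^v = c * (b * (e ^+ p * 'X^q)).
  move=> em uq b.
  have -> : b * 'X^u * (e * 'X^s) ^+ m * 'X^v = b * (e ^+ m * 'X^(u + s * m + v)).
    rewrite exprMn -exprM !exprD.
    have key (x y z w : {poly F}) : b * x * (y * z) * w = b * (y * (x * z * w)) by ring.
    exact: key.
  rewrite uq em /c exprD.
  have key (x y z w : {poly F}) : b * (x * y * (z * w)) = x * z * (b * (y * w)) by ring.
  exact: key.
(* The q-binomial index is M + n in the first theta sum and M - n - 1 in the second. *)
move=> ->; rewrite -/a -addnS big_split_ord /= addrC.
rewrite [X in _ + X](reindex_inj rev_ord_inj) /= mulrDr !mulr_sumr.
congr (_ + _); apply: eq_bigr => n _; rewrite -!exprM.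
  apply: monomial; first by rewrite exprD.
  have h : (M * n + M * (M + M - (M + n)) = M * M)%N.
    by rewrite -mulnDr; congr muln; have := ltn_ord n; lia.
  by rewrite binD2 -/a; have := congr1 (muln a) h; lia.
have nM := ltn_ord n; apply: monomial.
  have -> : e ^+ M = e ^+ (M - n.+1) * e ^+ n.+1 by rewrite -exprD subnK.
  by rewrite -mulrA -exprMn ee expr1n mulr1.
have [p h] : exists p, (M = p + n.+1)%N by exists (M - n.+1)%N; lia.
have -> : (M - n.+1 = p)%N by lia.
have h1 := sqrn_bin2 n.+1.
have h2 : ('C(M, 2) = 'C(p, 2) + 'C(n.+1, 2) + p * n.+1)%N by rewrite -binD2 -h.
have -> : (M + M - p = M + n.+1)%N by lia.
have ha : (a * n.+1 = s * n.+1 + t * n.+1)%N by rewrite -mulnDl.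
have h3 : (M * M + M * n.+1 = M * M + p * n.+1 + n.+1 * n.+1)%N by rewrite {2}h; lia.
have := congr1 (muln a) h1; have := congr1 (muln a) h3.
have hs : (s * M = s * p + s * n.+1)%N by rewrite -mulnDr -h.
by rewrite h2; lia.
Qed.

Lemma eulerp_leq N k L L' : (0 < k)%N -> (N <= L.+1)%N -> (L <= L')%N ->
  eqmodX N (eulerp k L') (eulerp k L).
Proof.
move=> k0 NL /subnKC <-; elim: (L' - L)%N => [|d IH]; first by rewrite addn0; reflexivity.
rewrite addnS {1}/eulerp big_ord_recr /= -/(eulerp k _) IH eqmodX_Xn; last nia.
by rewrite subr0 mulr1; reflexivity.
Qed.

Lemma eulerp_coef0 k L : (0 < k)%N -> (eulerp k L)`_0 = 1.
Proof.
move=> k0; rewrite coef0_prod big1 // => j _.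
by rewrite coefB coef1 coefXn (_ : (0 == k * j.+1)%N = false) ?subr0 //; lia.
Qed.

(** Both k and M - k are at least N, so the three q-factorials in the Gaussian binomial agree modulo
    X^N, and it is the inverse of one of them. *)
Lemma qbin_central N a M k : (0 < a)%N -> (N <= k)%N -> (k + N <= M)%N ->
  eqmodX N (eulerp a M * qbin 'X^a M k) 1.
Proof.
move=> a0 Nk kM; have NM : (N <= M)%N by lia.
have kM' : (k <= M)%N by lia.
have := qbin_qpoch ('X^a : {poly F}) kM'; rewrite !qpoch_eulerp => h.
have e1 L : (N <= L)%N -> eqmodX N (eulerp a L) (eulerp a N).
  by move=> NL; apply: eulerp_leq => //; lia.
apply: (@eqmodX_cancel _ _ (eulerp a N)); first by rewrite eulerp_coef0 ?oner_neq0.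
rewrite mulr1 (e1 M) //; move: (e1 M NM); rewrite -h e1 // e1; last lia.
by rewrite mulrA [eulerp a N * _ * _]mulrC [X in _ -> eqmodX _ X _]mulrA.
Qed.

(** In the finite form, terms with n < N have a central Gaussian binomial, which the Euler product
    cancels because 2 N <= M. The remaining terms vanish modulo X^N. *)
Lemma jacobi_triple (e : {poly F}) N s t M : e * e = 1 -> (0 < s)%N -> (0 < t)%N ->
  (2 * N <= M)%N ->
  eqmodX N (theta e s t M) (eulerp (s + t) M *
    \prod_(j < M) ((1 + e * 'X^(s + (s + t) * j)) * (1 + e * 'X^(t + (s + t) * j)))).
Proof.
move=> ee s0 t0 NM; rewrite finite_jacobi_triple //.
have st0 : (0 < s + t)%N by lia.
rewrite -(eulerp_leq st0 _ (leq_addl M M)); last lia.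
have term k n (p : {poly F}) : (N <= k)%N && (k + N <= M + M)%N || (N <= n)%N ->
    eqmodX N (eulerp (s + t) (M + M) * (qbin 'X^(s + t) (M + M) k * (p * 'X^n))) (p * 'X^n).
  case/orP=> [/andP[Nk kM]|Nn]; last by rewrite !(eqmodX_Xn _ Nn) !mulr0; reflexivity.
  by rewrite mulrA qbin_central // mul1r; reflexivity.
rewrite mulrDr !mulr_sumr /theta; apply: eqmodX_add.
  rewrite big_ord_recr /= term; last nia.
  rewrite [in X in _ + X]eqmodX_Xn; last nia.
  rewrite mulr0 addr0; apply: eqmodX_sum => n; symmetry; apply: term.
  by case: (leqP N n) => h; nia.
apply: eqmodX_sum => n; symmetry; apply: term.
by have := ltn_ord n; case: (leqP N n) => h; nia.
Qed.
End JacobiTriple.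

(** * Product formulas for phi, psi, A and Omega *)

Lemma big_ord_mul (T : Type) (idx : T) (op : Monoid.law idx) M d (f : nat -> T) :
  \big[op/idx]_(i < M * d) f i = \big[op/idx]_(j < M) \big[op/idx]_(i < d) f (j * d + i)%N.
Proof.
elim: M => [|M IH]; first by rewrite !big_ord0.
by rewrite mulSnr big_split_ord big_ord_recr /= IH.
Qed.

Section ThetaProducts.
Variable F : fieldType.

(** The q-Pochhammer symbol (q^c; q^a)_M. *)
Definition progression (M c a : nat) : {poly F} := \prod_(j < M) (1 - 'X^(c + a * j)).

Lemma eulerp_progression k M : eulerp F k M = progression M k k.
Proof. by apply: eq_bigr => j _; rewrite mulnS. Qed.

Lemma eulerp_split d k M :
  eulerp F k (M * d) = \prod_(i < d) progression M (k * i.+1) (k * d).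
Proof.
rewrite /eulerp (big_ord_mul _ _ _ (fun j => 1 - 'X^(k * j.+1))) exchange_big /=.
apply: eq_bigr => i _.
by apply: eq_bigr => j _; congr (1 - 'X^_); nia.
Qed.

Lemma progressionN M c a :
  \prod_(j < M) (1 + -1 * 'X^(c + a * j)) = progression M c a.
Proof. by apply: eq_bigr => j _; rewrite mulN1r. Qed.

Lemma progressionD M c a :
  \prod_(j < M) (1 + 1 * 'X^(c + a * j)) * progression M c a = progression M (c * 2) (a * 2).
Proof.
rewrite -big_split /=; apply: eq_bigr => j _.
have -> : (c * 2 + a * 2 * j = (c + a * j) * 2)%N by lia.
by rewrite exprM; ring.
Qed.

Section Truncated.
Variables (N M : nat).
Hypothesis NM : (2 * N <= M)%N.
Local Notation E k := (eulerp F k N).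
Local Notation "p === q" := (eqmodX N p q) (at level 70).

Let E_ge k L : (0 < k)%N -> (N <= L)%N -> E k === eulerp F k L.
Proof. by move=> k0 NL; symmetry; apply: eulerp_leq => //; lia. Qed.

(** For all four series, Euler products are split into progressions and compared with the triple
    product. Their lengths are chosen so that every progression has M factors. *)
Lemma theta_phi : theta (-1) 1 1 M * E 2 === E 1 ^+ 2.
Proof.
rewrite jacobi_triple ?mulrNN ?mulr1 // big_split /= !progressionN.
rewrite (@E_ge 2 M) // ?(@E_ge 1 (M * 2)) //; try lia.
rewrite eulerp_split !big_ord_recl big_ord0 /= /bump /=.
rewrite !eulerp_progression.
have key (x y : {poly F}) : y * (x * x) * y = (x * (y * 1)) ^+ 2 by ring.
apply: eq_eqmodX; exact: key.
Qed.

Lemma theta_psi : theta 1 3 1 M * E 1 === E 2 ^+ 2.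
Proof.
rewrite jacobi_triple ?mulr1 // big_split /=.
rewrite -[eulerp F _ M](@E_ge (3 + 1) M) // ?(@E_ge 1 (M * 4)) ?(@E_ge (3 + 1) (M * 2)) //; try lia.
(* One E(q^2) is split with step 8, to match the products (1 + x)(1 - x), the other with step 4, to
   match the factors left over from E(q). *)
rewrite expr2 {1}(@E_ge 2 (M * 4)) // ?(@E_ge 2 (M * 2)) //; try lia.
rewrite !eulerp_split !big_ord_recl !big_ord0 /= /bump /=.
have key (s2 s4 s6 s8 u1 u3 p1 p2 p3 p4 : {poly F}) : u3 * p3 = s6 -> u1 * p1 = s2 ->
    s4 * (s8 * 1) * (u3 * u1) * (p1 * (p2 * (p3 * (p4 * 1)))) =
    s2 * (s4 * (s6 * (s8 * 1))) * (p2 * (p4 * 1)).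
  by move=> <- <-; ring.
apply: eq_eqmodX; exact: key (progressionD M 3 4) (progressionD M 1 4).
Qed.

Lemma theta_A : theta 1 2 1 M * (E 1 * E 6) === E 2 * E 3 ^+ 2.
Proof.
rewrite jacobi_triple ?mulr1 // big_split /=.
rewrite (@E_ge 1 (M * 3)) ?(@E_ge 2 (M * 3)) ?(@E_ge 6 M) ?(@E_ge 3 M) //; try lia.
rewrite !eulerp_split !eulerp_progression !big_ord_recl !big_ord0 /= /bump /=.
have key (s2 s4 s6 u1 u2 p1 p2 p3 : {poly F}) : u2 * p2 = s4 -> u1 * p1 = s2 ->
    p3 * (u2 * u1) * (p1 * (p2 * (p3 * 1)) * s6) = s2 * (s4 * (s6 * 1)) * p3 ^+ 2.
  by move=> <- <-; ring.
apply: eq_eqmodX; exact: key (progressionD M 2 3) (progressionD M 1 3).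
Qed.

Lemma theta_Omega : theta (-1) 5 1 M * (E 2 * E 3) === E 1 * E 6 ^+ 2.
Proof.
rewrite jacobi_triple ?mulrNN ?mulr1 // big_split /= !progressionN.
rewrite (@E_ge 1 (M * 6)) ?(@E_ge 2 (M * 3)) ?(@E_ge 6 M) ?(@E_ge 3 (M * 2)) //; try lia.
rewrite !eulerp_split !eulerp_progression !big_ord_recl !big_ord0 /= /bump /=.
have key (p1 p2 p3 p4 p5 p6 : {poly F}) :
    p6 * (p5 * p1) * (p2 * (p4 * (p6 * 1)) * (p3 * (p6 * 1))) =
    p1 * (p2 * (p3 * (p4 * (p5 * (p6 * 1))))) * p6 ^+ 2 by ring.
apply: eq_eqmodX; exact: key.
Qed.
End Truncated.
End ThetaProducts.

(** * Dissection of phi and psi modulo 3 *)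

Lemma bin2_mul3D j i : 'C(j * 3 + i, 2) = (9 * 'C(j, 2) + 3 * j + 3 * i * j + 'C(i, 2))%N.
Proof. by rewrite binD2 (_ : j * 3 = j + j + j)%N ?binD2; have := sqrn_bin2 j; lia. Qed.

Lemma bin2_mul2D j i : 'C(j * 2 + i, 2) = (4 * 'C(j, 2) + j + 2 * i * j + 'C(i, 2))%N.
Proof. by rewrite binD2 (_ : j * 2 = j + j)%N ?binD2; have := sqrn_bin2 j; lia. Qed.

Lemma eqmodX_compXn (F : fieldType) N d (p q : {poly F}) : (0 < d)%N ->
  eqmodX N p q -> eqmodX N (p \Po 'X^d) (q \Po 'X^d).
Proof.
move=> d0 [h]; apply/eqmodXP; rewrite -comp_polyB.
apply: dvdp_trans (dvdp_comp_poly _ h).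
by rewrite comp_Xn_poly -exprM dvdp_exp2l // leq_pmull.
Qed.

Section Dissection.
Variable F : fieldType.

Lemma theta_comp (e : {poly F}) s t M d : e \Po 'X^d = e ->
  theta e s t M \Po 'X^d = theta e (s * d) (t * d) M.
Proof.
move=> ed; rewrite /theta comp_polyD !rmorph_sum /=.
congr (_ + _); apply: eq_bigr => j _.
  by rewrite comp_polyM rmorphXn /= ed comp_Xn_poly -exprM; congr (_ * 'X^_); nia.
by rewrite comp_polyM rmorphXn /= ed comp_Xn_poly -exprM; congr (_ * 'X^_); nia.
Qed.

Lemma eulerp_comp k L d : eulerp F k L \Po 'X^d = eulerp F (k * d) L.
Proof.
rewrite /eulerp rmorph_prod /=; apply: eq_bigr => j _.
by rewrite comp_polyB comp_Xn_poly -exprM rmorph1 mulnA [(d * k)%N]mulnC.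
Qed.

(** Multiples of 3 give phi(q^9). The residues 1 and 2 are exchanged by n -> -n, and (3 j + 1)^2 = 3
    (3 j^2 + 2 j) + 1 turns each into -q Omega(q^3). *)
Lemma theta_phi_dissection M : theta (-1) 1 1 (M * 3) =
  theta (-1) 3 3 M \Po 'X^3 - 2%:R * 'X * (theta (-1) 5 1 M \Po 'X^3) :> {poly F}.
Proof.
rewrite !theta_comp ?rmorphN1 // /theta.
rewrite (big_ord_mul _ _ _ (fun n => (-1) ^+ n * 'X^((1 + 1) * 'C(n, 2) + 1 * n))).
rewrite (big_ord_mul _ _ _ (fun n => (-1) ^+ n.+1 * 'X^((1 + 1) * 'C(n.+1, 2) + 1 * n.+1))).
rewrite mulrDr !mulr_sumr -!big_split -sumrN -big_split /=; apply: eq_bigr => j _; lazy beta.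
have sq n : ((1 + 1) * 'C(n, 2) + 1 * n = n * n)%N by rewrite sqrn_bin2 mul1n.
have -> : ((3 * 3 + 3 * 3) * 'C(j, 2) + 3 * 3 * j = j * 3 * (j * 3))%N.
  by have := sqrn_bin2 j; lia.
have -> : ((3 * 3 + 3 * 3) * 'C(j.+1, 2) + 3 * 3 * j.+1 = (j * 3).+3 * (j * 3).+3)%N.
  by have := sqrn_bin2 j.+1; lia.
have sgn : (-1) ^+ (j * 3) = (-1) ^+ j :> {poly F}.
  by rewrite mulnC exprM -[(-1) ^+ 3]signr_odd.
have e1 : 'X * 'X^((5 * 3 + 1 * 3) * 'C(j, 2) + 5 * 3 * j) =
    'X^((j * 3).+1 * (j * 3).+1) :> {poly F}.
  by rewrite -exprS; congr 'X^_; have := sqrn_bin2 j; lia.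
have e2 : 'X * 'X^((5 * 3 + 1 * 3) * 'C(j.+1, 2) + 1 * 3 * j.+1) =
    'X^((j * 3).+2 * (j * 3).+2) :> {poly F}.
  by rewrite -exprS; congr 'X^_; have := sqrn_bin2 j.+1; lia.
have key (x u v y0 y1 y2 y3 t : {poly F}) : x * u = y1 -> x * v = y2 ->
    t * y0 + (-1 * t * y1 + (-1 * (-1 * t) * y2 + 0)) +
    (-1 * t * y1 + (-1 * (-1 * t) * y2 + (-1 * (-1 * (-1 * t)) * y3 + 0))) =
    t * y0 + -1 * t * y3 - (2%:R * x * (t * u) + 2%:R * x * (-1 * t * v)).
  by move=> <- <-; ring.
set rhs := (X in _ = X).
rewrite !big_ord_recl !big_ord0 !sq /= /bump /= ?addnS ?add0n ?addn0.
rewrite /rhs !(exprS _ (_ * 3).+2) !(exprS _ (_ * 3).+1) !(exprS _ (_ * 3)) (exprS _ j) sgn.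
exact: key e1 e2.
Qed.

(** In 2 n^2 + n, the indices n = 3 m and 3 m + 1 give the terms 2 m and -2 m - 1 of A(q^3), hence
    its length 2 M. The indices n = 3 m - 1 give q psi(q^9). *)
Lemma theta_psi_dissection M : theta 1 3 1 (M * 3) =
  theta 1 2 1 (M * 2) \Po 'X^3 + 'X * (theta 1 9 3 M \Po 'X^3) :> {poly F}.
Proof.
rewrite !theta_comp ?rmorph1 // /theta.
under eq_bigr => n _ do rewrite expr1n mul1r.
under [X in _ + X]eq_bigr => n _ do rewrite expr1n mul1r.
rewrite (big_ord_mul _ _ _ (fun n => 'X^((3 + 1) * 'C(n, 2) + 3 * n))).
rewrite (big_ord_mul _ _ _ (fun n => 'X^((3 + 1) * 'C(n.+1, 2) + 1 * n.+1))).
under [X in _ = X + _ + _]eq_bigr => n _ do rewrite expr1n mul1r.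
under [X in _ = _ + X + _]eq_bigr => n _ do rewrite expr1n mul1r.
rewrite (big_ord_mul _ _ _ (fun n => 'X^((2 * 3 + 1 * 3) * 'C(n, 2) + 2 * 3 * n))).
rewrite (big_ord_mul _ _ _ (fun n => 'X^((2 * 3 + 1 * 3) * 'C(n.+1, 2) + 1 * 3 * n.+1))).
rewrite mulrDr !mulr_sumr -!big_split; apply: eq_bigr => j _; lazy beta.
have key (x y1 y2 a0 a1 b0 b1 c0 c1 a0' a1' b0' b1' c0' c1' : {poly F}) :
    a0' = a0 -> a1' = a1 -> b0' = b0 -> b1' = b1 -> c0' = x * (y1 * c0) -> c1' = x * (y2 * c1) ->
    a0' + (b0' + (c1' + 0)) + (c0' + (a1' + (b1' + 0))) =
    a0 + (a1 + 0) + (b0 + (b1 + 0)) + (x * (y1 * c0) + x * (y2 * c1)).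
  by move=> -> -> -> -> -> ->; ring.
rewrite !big_ord_recl !big_ord0; apply: key;
  rewrite ?expr1n ?mul1r -?exprS; congr 'X^_; rewrite /bump ?add1n ?lift0 /=;
  have [c0 c1 c2 c3] : [/\ 'C(0, 2) = 0, 'C(1, 2) = 0, 'C(2, 2) = 1 & 'C(3, 2) = 3]%N by [];
  rewrite -?addnS ?bin2_mul3D ?bin2_mul2D ?c0 ?c1 ?c2 ?c3 ?[in RHS]binS ?bin1; lia.
Qed.
End Dissection.

(** * The norm along the cube roots of unity *)

Section CubicNorm.
Variables (F : fieldType) (w : F).
Hypothesis w_root : w ^+ 2 + w + 1 = 0.

Definition cubic_norm (p : {poly F}) : {poly F} :=
  p * (p \Po (w *: 'X)) * (p \Po (w ^+ 2 *: 'X)).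

Lemma cubic_normM p q : cubic_norm (p * q) = cubic_norm p * cubic_norm q.
Proof. rewrite /cubic_norm !comp_polyM; ring. Qed.

Lemma cubic_norm_eqmodX N p q :
  eqmodX N p q -> eqmodX N (cubic_norm p) (cubic_norm q).
Proof.
move=> h; rewrite /cubic_norm (eqmodX_scale w h) (eqmodX_scale (w ^+ 2) h) h.
reflexivity.
Qed.

Lemma cube_root1 : w ^+ 3 = 1.
Proof.
have : (w - 1) * (w ^+ 2 + w + 1) = 0 by rewrite w_root mulr0.
by move/eqP; rewrite (_ : _ * _ = w ^+ 3 - 1); [rewrite subr_eq0 => /eqP|ring].
Qed.

(** Both substitutions fix polynomials in X^3, so this is a^3 + b^3 = (a + b)(a + w b)(a + w^2
    b). *)
Lemma cubic_norm_dissected p r :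
  cubic_norm (p \Po 'X^3 + 'X * (r \Po 'X^3)) =
  (p ^+ 3 + 'X * r ^+ 3) \Po 'X^3.
Proof.
have w3 := cube_root1; have w6 : (w ^+ 2) ^+ 3 = 1 by rewrite exprAC w3 expr1n.
have fixX3 (v : F) q : v ^+ 3 = 1 -> (q \Po 'X^3) \Po (v *: 'X) = q \Po 'X^3.
  by move=> v3; rewrite -comp_polyA comp_Xn_poly exprZn v3 scale1r.
rewrite /cubic_norm !comp_polyD !comp_polyM !comp_polyX !fixX3 //.
rewrite -!mul_polyC rmorphXn /=; move: (p \Po _) (r \Po _) => a b.
have wP : (w%:P) ^+ 2 = - w%:P - 1 :> {poly F}.
  by rewrite -rmorphXn /= -polyCN -polyCB; congr (_%:P); apply/eqP;
     rewrite -subr_eq0 opprD !opprK addrA w_root.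
rewrite wP; move: (w%:P) wP => v wP.
have key (x : {poly F}) : (a + x * b) * (a + v * x * b) * (a + (- v - 1) * x * b) -
    (a * (a * a) + x ^+ 3 * (b * (b * b))) =
    (v ^+ 2 + v + 1) * (- a * x ^+ 2 * b ^+ 2 - x ^+ 3 * b ^+ 3) by ring.
apply/eqP; rewrite -subr_eq0 key wP.
by rewrite addrAC subrK addNr mul0r.
Qed.

End CubicNorm.

(** Fraction-free form of P = n1^2 / n2 with ni = ui^4 / vi. It serves for P the norm of phi or of
    psi. *)
Lemma quotient_norm_combine (F : fieldType) N (P n1 n2 u1 u2 v1 v2 : {poly F}) :
  eqmodX N (n1 * v1) (u1 ^+ 4) -> eqmodX N (n2 * v2) (u2 ^+ 4) ->
  eqmodX N (P * n2) (n1 * n1) ->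
  eqmodX N (P * (u2 ^+ 4 * v1 ^+ 2)) (u1 ^+ 8 * v2).
Proof.
move=> h1 h2 h; rewrite -h2 (_ : P * _ = P * n2 * (v2 * v1 ^+ 2)); last by ring.
by rewrite h (exprM u1 4 2) -h1; apply: eq_eqmodX; ring.
Qed.

Lemma level6_combine (F : fieldType) N (p s a r e1 e2 e3 e6 x : {poly F}) :
  (e1 ^+ 3 * e2 ^+ 3 * e3 ^+ 3 * e6 ^+ 2)`_0 != 0 ->
  eqmodX N (p * e6) (e3 ^+ 2) -> eqmodX N (s * e3) (e6 ^+ 2) ->
  eqmodX N ((p ^+ 3 - 8%:R * x * r ^+ 3) * (e2 ^+ 4 * e3 ^+ 2)) (e1 ^+ 8 * e6) ->
  eqmodX N ((a ^+ 3 + x * s ^+ 3) * (e1 ^+ 4 * e6 ^+ 2)) (e2 ^+ 8 * e3) ->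
  eqmodX N (a * (e1 * e6)) (e2 * e3 ^+ 2) ->
  eqmodX N (r * (e2 * e3)) (e1 * e6 ^+ 2) ->
  eqmodX N (9%:R * (e1 * e2 ^+ 4 * e3 ^+ 8))
    (8%:R * (e2 ^+ 9 * e3 ^+ 3 * e6) + e1 ^+ 9 * e6 ^+ 4).
Proof.
(* e1^4 e6^2 k1 + 8 e2^4 e3^2 k2 eliminates x. *)
move=> u0 hp hs h1 h2 ha hr; apply: (eqmodX_cancel u0).
(* The factors (e2 e3 e6)^3 here and (e1 e3 e6)^3 in [k2] complete p, r, a, s to the products that
   [hp], [hr], [ha], [hs] evaluate. *)
have k1 : eqmodX N (((p * e6) ^+ 3 * (e2 * e3) ^+ 3 - 8%:R * x * (r * (e2 * e3)) ^+ 3 * e6 ^+ 3) *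
    (e2 ^+ 4 * e3 ^+ 2)) (e1 ^+ 8 * e6 * (e6 * (e2 * e3)) ^+ 3).
  by rewrite -h1; apply: eq_eqmodX; ring.
have k2 : eqmodX N (((a * (e1 * e6)) ^+ 3 * e3 ^+ 3 + x * (s * e3) ^+ 3 * (e1 * e6) ^+ 3) *
    (e1 ^+ 4 * e6 ^+ 2)) (e2 ^+ 8 * e3 * (e1 * e6 * e3) ^+ 3).
  by rewrite -h2; apply: eq_eqmodX; ring.
rewrite hp hr in k1; rewrite ha hs in k2.
rewrite [X in eqmodX _ _ X](_ : _ = e1 ^+ 4 * e6 ^+ 2 * (e1 ^+ 8 * e6 * (e6 * (e2 * e3)) ^+ 3) +
  8%:R * (e2 ^+ 4 * e3 ^+ 2) * (e2 ^+ 8 * e3 * (e1 * e6 * e3) ^+ 3)); last by ring.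
by rewrite -k1 -k2; apply: eq_eqmodX; ring.
Qed.

(** * Norms of Euler products and the level 6 identity *)

Section EulerNorm.
Variables (F : fieldType) (w : F).
Hypothesis w_root : w ^+ 2 + w + 1 = 0.

Lemma cubic_norm_subXn n (v : F) : w ^+ n = v ->
  cubic_norm w (1 - 'X^n) = (1 - 'X^n) * (1 - v%:P * 'X^n) * (1 - v%:P ^+ 2 * 'X^n).
Proof.
move=> <-; rewrite /cubic_norm !comp_polyB !comp_Xn_poly !rmorph1 !exprZn -!mul_polyC.
by rewrite -rmorphXn /= exprAC.
Qed.

(** With v = w^c, each factor is an instance of (1 - x)(1 - v x)(1 - v^2 x) = 1 - x^3. *)
Lemma cubic_norm_progression L c a : (w ^+ c) ^+ 2 + w ^+ c + 1 = 0 -> w ^+ a = 1 ->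
  cubic_norm w (progression F L c a) = progression F L (c * 3) (a * 3).
Proof.
move=> wc wa; rewrite (big_morph _ (@cubic_normM _ w) (_ : _ = 1)); last first.
  by rewrite /cubic_norm !rmorph1 !mulr1.
apply: eq_bigr => j _; rewrite (@cubic_norm_subXn _ (w ^+ c)); last first.
  by rewrite exprD exprM wa expr1n mulr1.
have -> : (c * 3 + a * 3 * j = (c + a * j) * 3)%N by lia.
rewrite exprM; move: ('X^(c + _)) => x.
have vP : (w ^+ c)%:P ^+ 2 + (w ^+ c)%:P + 1 = 0 :> {poly F}.
  by rewrite -rmorphXn /= -polyCD -polyC1 -polyCD wc.
move: ((w ^+ c)%:P) vP => v vP; apply/eqP; rewrite -subr_eq0.
have -> : (1 - x) * (1 - v * x) * (1 - v ^+ 2 * x) - (1 - x ^+ 3) =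
  (v ^+ 2 + v + 1) * (- x + v * x ^+ 2 - (v - 1) * x ^+ 3) by ring.
by rewrite vP mul0r.
Qed.

Lemma cubic_norm_progression3 L c a : w ^+ c = 1 -> w ^+ a = 1 ->
  cubic_norm w (progression F L c a) = progression F L c a ^+ 3.
Proof.
move=> wc wa; rewrite (big_morph _ (@cubic_normM _ w) (_ : _ = 1)); last first.
  by rewrite /cubic_norm !rmorph1 !mulr1.
rewrite -prodrXl; apply: eq_bigr => j _; rewrite (@cubic_norm_subXn _ 1); last first.
  by rewrite exprD exprM wa expr1n mulr1.
by rewrite expr1n !mul1r -mulrA.
Qed.

(** Among the exponents k m, those with m prime to 3 have norms forming E(q^(3k)) without its
    multiples of 9k, which E(q^(9k)) restores. Those with 3 dividing m are merely cubed. *)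
Lemma cubic_norm_eulerp k L : (w ^+ k) ^+ 2 + w ^+ k + 1 = 0 ->
  cubic_norm w (eulerp F k (L * 3)) * eulerp F (k * 9) L =
  eulerp F (k * 3) (L * 3) * eulerp F (k * 3) L ^+ 3.
Proof.
move=> wk; have w3 := cube_root1 w_root.
have wk3 : w ^+ (k * 3) = 1 by rewrite mulnC exprM w3 expr1n.
have wk2 : (w ^+ (k * 2)) ^+ 2 + w ^+ (k * 2) + 1 = 0.
  rewrite -exprM (_ : k * 2 * 2 = k * 3 + k)%N; last lia.
  by rewrite exprD wk3 mul1r exprM [w ^+ k + _]addrC.
rewrite !eulerp_split !big_ord_recl !big_ord0 /= /bump /= !mulr1 !muln1 !cubic_normM.
rewrite (cubic_norm_progression _ wk wk3) (cubic_norm_progression _ wk2 wk3).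
rewrite cubic_norm_progression3 // !eulerp_progression.
rewrite -!mulnA /=.
have key (p1 p2 p3 q : {poly F}) : p1 * (p2 * q ^+ 3) * p3 = p1 * (p2 * p3) * q ^+ 3 by ring.
exact: key.
Qed.

Lemma cubic_norm_eulerp_eqmodX N k : (0 < k)%N -> (w ^+ k) ^+ 2 + w ^+ k + 1 = 0 ->
  eqmodX N (cubic_norm w (eulerp F k N) * eulerp F (k * 9) N) (eulerp F (k * 3) N ^+ 4).
Proof.
move=> k0 wk; have e d L : (0 < d)%N -> (N <= L)%N -> eqmodX N (eulerp F d L) (eulerp F d N).
  by move=> d0 NL; apply: eulerp_leq => //; lia.
rewrite -(cubic_norm_eqmodX w (e k (N * 3)%N k0 _)); last lia.
rewrite cubic_norm_eulerp // [X in X * _]e; [|lia..].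
by rewrite -exprS; reflexivity.
Qed.

Variable N : nat.
Local Notation E k := (eulerp F k N).
Local Notation "p === q" := (eqmodX N p q) (at level 70).

Let E_ge k L : (0 < k)%N -> (N <= L)%N -> E k === eulerp F k L.
Proof. by move=> k0 NL; symmetry; apply: eulerp_leq => //; lia. Qed.

Let norm1 K : eqmodX K (cubic_norm w (eulerp F 1 K) * eulerp F 9 K) (eulerp F 3 K ^+ 4).
Proof. exact: cubic_norm_eulerp_eqmodX. Qed.

Let norm2 K : eqmodX K (cubic_norm w (eulerp F 2 K) * eulerp F 18 K) (eulerp F 6 K ^+ 4).
Proof.
apply: cubic_norm_eulerp_eqmodX => //.
have -> : (w ^+ 2) ^+ 2 + w ^+ 2 + 1 = (w ^+ 2 + w + 1) * (w ^+ 2 - w + 1) by ring.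
by rewrite w_root mul0r.
Qed.

(** After q -> q^3 the first factor is the norm of phi(q) = E1^2 / E2. The substitution requires
    precision 3 N. *)
Lemma phi_cubic_identity M : (2 * N <= M)%N ->
  (theta (-1) 3 3 M ^+ 3 - 8%:R * 'X * theta (-1) 5 1 M ^+ 3) * (E 2 ^+ 4 * E 3 ^+ 2)
  === E 1 ^+ 8 * E 6.
Proof.
move=> NM; set K := (3 * N)%N; have NK : (N <= K)%N by lia.
rewrite !(fun k k0 => @E_ge k K k0 NK) //; apply: (@eqmodX_expand _ _ 3) => //.
set p := theta _ 3 3 M; set r := theta _ 5 1 M.
have -> : p ^+ 3 - 8%:R * 'X * r ^+ 3 = p ^+ 3 + 'X * (- 2%:R * r) ^+ 3 by ring.
rewrite !comp_polyM -(cubic_norm_dissected w_root) !eulerp_comp.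
have -> : p \Po 'X^3 + 'X * ((- 2%:R * r) \Po 'X^3) = theta (-1) 1 1 (M * 3).
  rewrite theta_phi_dissection -/p -/r comp_polyM rmorphN rmorph_nat.
  by move: (p \Po _) (r \Po _) => x y; ring.
have KM : (2 * K <= M * 3)%N by lia.
have := cubic_norm_eqmodX w (theta_phi F KM).
rewrite expr2 !cubic_normM => h.
exact: quotient_norm_combine (norm1 K) (norm2 K) h.
Qed.

Lemma psi_cubic_identity M : (2 * N <= M)%N ->
  (theta 1 2 1 (M * 2) ^+ 3 + 'X * theta 1 9 3 M ^+ 3) * (E 1 ^+ 4 * E 6 ^+ 2)
  === E 2 ^+ 8 * E 3.
Proof.
move=> NM; set K := (3 * N)%N; have NK : (N <= K)%N by lia.
rewrite !(fun k k0 => @E_ge k K k0 NK) //; apply: (@eqmodX_expand _ _ 3) => //.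
rewrite !comp_polyM -(cubic_norm_dissected w_root) !eulerp_comp -theta_psi_dissection.
have KM : (2 * K <= M * 3)%N by lia.
have := cubic_norm_eqmodX w (theta_psi F KM).
rewrite expr2 !cubic_normM => h.
exact: quotient_norm_combine (norm2 K) (norm1 K) h.
Qed.

Lemma level6_identity :
  9%:R * (E 1 * E 2 ^+ 4 * E 3 ^+ 8) === 8%:R * (E 2 ^+ 9 * E 3 ^+ 3 * E 6) + E 1 ^+ 9 * E 6 ^+ 4.
Proof.
pose M := (2 * N)%N; have NM : (2 * N <= M)%N by [].
have NM2 : (2 * N <= M * 2)%N by lia.
have E0 k : (0 < k)%N -> (E k)`_0 = 1 by exact: eulerp_coef0.
(* The product formulas of phi and psi at q^3. *)
have phi3 := @eqmodX_compXn _ N 3 _ _ isT (theta_phi F NM).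
rewrite !comp_polyM theta_comp ?rmorphN1 // !eulerp_comp in phi3.
have psi3 := @eqmodX_compXn _ N 3 _ _ isT (theta_psi F NM).
rewrite !comp_polyM theta_comp ?rmorph1 // !eulerp_comp in psi3.
apply: (level6_combine _ phi3 psi3 (phi_cubic_identity NM) (psi_cubic_identity NM)
  (theta_A F NM2) (theta_Omega F NM)).
by rewrite !coef0M !E0 // !mulr1 oner_neq0.
Qed.
End EulerNorm.

(** * Descent to rational coefficients and return to power series *)

Section FormalPowerSeries.
Variable N : nat.
Local Notation "p === q" := (eqmodX N p q) (at level 70).
Local Notation e k := (eulerp rat k N).

(** The cube root of unity lives in [algC]; divisibility by X^N descends along the field
    extension. *)
Lemma level6_identity_rat :
  9%:R * (e 1 * e 2 ^+ 4 * e 3 ^+ 8) === 8%:R * (e 2 ^+ 9 * e 3 ^+ 3 * e 6) + e 1 ^+ 9 * e 6 ^+ 4.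
Proof.
have [w w_root] : exists w : algC, w ^+ 2 + w + 1 = 0.
  have [w wE] := @solve_monicpoly algC 2 (fun=> -1) isT.
  exists w; rewrite wE !big_ord_recl big_ord0 /= expr0 expr1; ring.
have eE k : map_poly ratr (e k) = eulerp algC k N.
  rewrite rmorph_prod; apply: eq_bigr => j _ /=.
  by rewrite rmorphB rmorph1 /= map_polyXn.
apply/(eqmodX_map (ratr : {rmorphism rat -> algC})).
rewrite !rmorphD !rmorphM /= !rmorph_nat !eE.
exact: level6_identity w_root N.
Qed.

Lemma trunc_Eq k : (0 < k)%N -> trunc N (Eq k) === e k.
Proof.
move=> k0; apply/eqmodX_coef => n nN; rewrite coef_poly nN /Eq big_add1 big_mkord.
by symmetry; move/eqmodX_coef: (@eulerp_leq rat n.+1 k n N k0 (leqnn _) (ltnW nN)); apply.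
Qed.

End FormalPowerSeries.

Lemma fmul_at0 f g : fmul f g 0%N = f 0%N * g 0%N.
Proof. by rewrite /fmul big_ord_recl big_ord0 addr0. Qed.

Lemma fpow_at0 f k : fpow f k 0%N = f 0%N ^+ k.
Proof. by elim: k => [//|k IH]; rewrite /= fmul_at0 IH exprS. Qed.

Lemma Eq_at0 k : Eq k 0%N = 1.
Proof. by rewrite /Eq big_geq // coef1. Qed.

(** * The relation between gamma and xi *)

Section EtaQuotients.
Variable N : nat.
Local Notation "p === q" := (eqmodX N p q) (at level 70).
Local Notation e k := (eulerp rat k N).

Lemma trunc_fdiv f : f 0%N != 0 -> forall p, trunc N f === p ->
  p * trunc N (Defs.finv f) === 1.
Proof. by move=> f0 p <-; apply: truncV. Qed.

Lemma trunc_gamma : trunc N gamma * e 3 ^+ 15 === e 1 ^+ 5 * e 2 ^+ 5 * e 6 ^+ 5.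
Proof.
have f0 : fpow (Eq 3) 15 0%N != 0 by rewrite fpow_at0 Eq_at0 expr1n oner_neq0.
have h3 : trunc N (fpow (Eq 3) 15) === e 3 ^+ 15 by rewrite truncX trunc_Eq //; reflexivity.
have hv := trunc_fdiv f0 h3.
rewrite /gamma truncM truncX truncM truncX truncM truncX !trunc_Eq //.
move: hv; move: (trunc _ _) (e 1) (e 2) (e 3) (e 6) => v e1 e2 e3 e6 hv.
rewrite [X in X === _](_ : _ = e1 ^+ 5 * e2 ^+ 5 * e6 ^+ 5 * (e3 ^+ 15 * v)); last by ring.
by rewrite hv mulr1; reflexivity.
Qed.

Lemma trunc_xi : trunc N xi * (e 1 * e 3 ^+ 5) === e 2 ^+ 5 * e 6.
Proof.
have f0 : fmul (Eq 1) (fpow (Eq 3) 5) 0%N != 0.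
  by rewrite fmul_at0 fpow_at0 !Eq_at0 expr1n mulr1 oner_neq0.
have h3 : trunc N (fmul (Eq 1) (fpow (Eq 3) 5)) === e 1 * e 3 ^+ 5.
  by rewrite truncM truncX !trunc_Eq //; reflexivity.
have hv := trunc_fdiv f0 h3.
rewrite /xi truncM truncM truncX !trunc_Eq //.
move: hv; move: (trunc _ _) (e 1) (e 2) (e 3) (e 6) => v e1 e2 e3 e6 hv.
rewrite [X in X === _](_ : _ = e2 ^+ 5 * e6 * (e1 * e3 ^+ 5 * v)); last by ring.
by rewrite hv mulr1; reflexivity.
Qed.

Lemma trunc_gamma_xi :
  trunc N gamma ^+ 6 === trunc N xi ^+ 10 * (9%:R - 8%:R * trunc N xi) ^+ 5.
Proof.
(* This is e1^15 e2^20 e3^90, a common denominator of gamma^6, with e3^90, and of xi^10 (9 - 8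
   xi)^5, where 9 - 8 xi has denominator e2^4 e3^8. *)
apply: (@eqmodX_cancel _ _ ((e 1 ^+ 3 * e 2 ^+ 4) ^+ 5 * (e 3 ^+ 15) ^+ 6)).
  by rewrite !coef0M !eulerp_coef0 // !mulr1 oner_neq0.
move: trunc_gamma trunc_xi (level6_identity_rat N).
move: (trunc _ _) (trunc _ _) (e 1) (e 2) (e 3) (e 6) => x g e1 e2 e3 e6 hg hx h6.
have hd : (9%:R - 8%:R * x) * (e1 * e3 ^+ 5) * (e2 ^+ 4 * e3 ^+ 3) === e1 ^+ 9 * e6 ^+ 4.
  rewrite [X in X === _](_ : _ = 9%:R * (e1 * e2 ^+ 4 * e3 ^+ 8) -
    8%:R * (x * (e1 * e3 ^+ 5)) * (e2 ^+ 4 * e3 ^+ 3)); last by ring.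
  by rewrite hx h6; apply: eq_eqmodX; ring.
move: (9%:R - _) hd => d hd.
have -> : (e1 ^+ 3 * e2 ^+ 4) ^+ 5 * (e3 ^+ 15) ^+ 6 * g ^+ 6 =
    (e1 ^+ 3 * e2 ^+ 4) ^+ 5 * (g * e3 ^+ 15) ^+ 6 by ring.
have -> : (e1 ^+ 3 * e2 ^+ 4) ^+ 5 * (e3 ^+ 15) ^+ 6 * (x ^+ 10 * d ^+ 5) =
    ((x * (e1 * e3 ^+ 5)) ^+ 2 * (d * (e1 * e3 ^+ 5) * (e2 ^+ 4 * e3 ^+ 3))) ^+ 5.
  (* Both sides are fifth powers, so [ring] only has to compare the bases. *)
  rewrite -!exprM (exprM e3 18 5) (exprM x 2 5) -!exprMn; congr (_ ^+ 5).
  by move: d x {hd hx hg h6 g e6} => d x; ring.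
rewrite hg hx hd -!exprMn -exprM (exprM _ 6 5) -exprMn; apply: eq_eqmodX.
by congr (_ ^+ 5); ring.
Qed.

End EtaQuotients.

Lemma xi_polynomial_expansion (R : comNzRingType) (x : {poly R}) :
  x ^+ 10 * (9%:R - 8%:R * x) ^+ 5 =
    (3 ^+ 10 : R) *: x ^+ 10
    - (2 ^+ 3 * 3 ^+ 8 * 5 : R) *: x ^+ 11
    + (2 ^+ 7 * 3 ^+ 6 * 5 : R) *: x ^+ 12
    - (2 ^+ 10 * 3 ^+ 4 * 5 : R) *: x ^+ 13
    + (2 ^+ 12 * 3 ^+ 2 * 5 : R) *: x ^+ 14
    - (2 ^+ 15 : R) *: x ^+ 15.
Proof.
have cX (c : R) k : (c ^+ k)%:P = c%:P ^+ k by rewrite rmorphXn.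
rewrite -!mul_polyC 8!polyCM !cX !polyC_natr; ring.
Qed.

(* Coefficients written as products of prime powers (large decimal numerals
   in ring_scope are unary nats):
   59049 = 3^10, 262440 = 2^3*3^8*5, 466560 = 2^7*3^6*5,
   414720 = 2^10*3^4*5, 184320 = 2^12*3^2*5, 32768 = 2^15. *)
Theorem theorem2p1 : forall n : nat,
  fpow gamma 6 n =
    (3 ^+ 10 : rat) * fpow xi 10 n
    - (2 ^+ 3 * 3 ^+ 8 * 5 : rat) * fpow xi 11 n
    + (2 ^+ 7 * 3 ^+ 6 * 5 : rat) * fpow xi 12 n
    - (2 ^+ 10 * 3 ^+ 4 * 5 : rat) * fpow xi 13 n
    + (2 ^+ 12 * 3 ^+ 2 * 5 : rat) * fpow xi 14 n
    - (2 ^+ 15 : rat) * fpow xi 15 n.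
Proof.
(* Precision n + 1 is what coefficient n requires. *)
move=> n; have powE f k : fpow f k n = (trunc n.+1 f ^+ k)`_n.
  have /eqmodX_coef/(_ n (ltnSn n)) <- := truncX n.+1 f k.
  by rewrite coef_poly ltnSn.
rewrite !powE; have /eqmodX_coef/(_ n (ltnSn n)) -> := trunc_gamma_xi n.+1.
by rewrite xi_polynomial_expansion !(coefD, coefN, coefZ).
Qed.
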